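(* Let $k\ge1$ be an integer, $\alpha>0$, and let $F(x)=[1+x^{-\alpha}]^{-1/k}$ for $x>0$. Let $N$ be a random variable with values in $\{1,2,\ldots\}$ and let $c\in(0,1)$. Then $F$ is $N$-max stable with constant $c$ if and only if $N$ has the Harris($c^{-\alpha},k$) law.
   Context: For a random variable $X>0$ with continuous distribution function $F$, and a $\{1,2,\ldots\}$-valued random variable $N$ independent of $X$ with probability generating function $Q(s)=E[s^N]$, $0\le s\le1$, $F$ is called $N$-max stable with constant $c\in(0,1)$ if $Q[F(x)]=F(cx)$ for all $x>0$. The Harris($a,k$) law, with $a>1$ real and $k\ge1$ an integer, is the law on $\{1,2,\ldots\}$ with probability generating function $s/[a-(a-1)s^k]^{1/k}$. *)

(* Defs.v *)
From HB Require Import structures.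
From mathcomp Require Import all_boot all_order all_algebra.
From mathcomp Require Import all_classical all_reals all_analysis.
Set Implicit Arguments.
Unset Strict Implicit.
Unset Printing Implicit Defensive.
Import Order.TTheory GRing.Theory Num.Theory.
Import numFieldNormedType.Exports.
Local Open Scope classical_set_scope.
Local Open Scope ring_scope.

(* Q(s) = E[s^N], extended-real valued like every library expectation. *)
Definition pgf d (T : measurableType d) (R : realType) (P : probability T R)
    (N : {RV P >-> nat}) (s : R) : \bar R :=
  'E_P[fun w => (s ^+ N w)%R]%E.

Definition positive_continuous_df (R : realType) (F : R -> R) : Prop :=
  continuous F /\
  exists (d : measure_display) (T : measurableType d) (P : probability T R)
    (X : {RV P >-> R}),
    (forall w, 0 < X w) /\ (forall x, cdf X x = (F x)%:E).

(* The variable X behind F lives on a space of its own, hence may always be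
   taken independent of N; the functional equation involves only F and the
   law of N. *)
Definition max_stable d (T : measurableType d) (R : realType)
    (P : probability T R) (N : {RV P >-> nat}) (c : R) (F : R -> R) : Prop :=
  [/\ positive_continuous_df F,
      (forall w, (0 < N w)%N),
      0 < c < 1 &
      forall x : R, 0 < x -> pgf N (F x) = (F (c * x))%:E].

Definition Harris_pgf (R : realType) (a : R) (k : nat) (s : R) : R :=
  s / (a - (a - 1) * s ^+ k) `^ (k%:R^-1).

Definition has_Harris_law d (T : measurableType d) (R : realType)
    (P : probability T R) (N : {RV P >-> nat}) (a : R) (k : nat) : Prop :=
  [/\ 1 < a, (0 < k)%N,
      (forall w, (0 < N w)%N) &
      forall s : R, 0 <= s <= 1 -> pgf N s = (Harris_pgf a k s)%:E].

(* Extended by 0 to x <= 0, as the distribution function of a positive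
   random variable must be. *)
Definition gen_log_logistic_df (R : realType) (alpha : R) (k : nat) (x : R) : R :=
  if 0 < x then (1 + x `^ (- alpha)) `^ (- k%:R^-1) else 0.

(* Main.v *)
Require Import Defs.
From HB Require Import structures.
From mathcomp Require Import all_boot all_order all_algebra.
From mathcomp Require Import all_classical all_reals all_analysis.
From mathcomp Require Import measurable_realfun ring.
Set Implicit Arguments.
Unset Strict Implicit.
Unset Printing Implicit Defensive.
Import Order.TTheory GRing.Theory Num.Theory.
Import numFieldNormedType.Exports.
Local Open Scope classical_set_scope.
Local Open Scope ring_scope.

(* With a = c^(-alpha), the Harris generating function sends F x to F (c x) for
   every x > 0. As F maps (0, oo) onto (0, 1), the functional equation of max
   stability is therefore the same as equality of the generating function of N
   with the Harris one on (0, 1); both take the values 0 at 0 and 1 at 1. That F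
   is the distribution function of a positive random variable is seen by
   evaluating its quantile function at a uniform variable on [0, 1]. *)

(* The value 1 off (0, 1) keeps the quantile function positive everywhere. *)
Definition gen_log_logistic_quantile (R : realType) (alpha : R) (k : nat) (u : R) : R :=
  if 0 < u < 1 then (u `^ (- k%:R) - 1) `^ (- alpha^-1) else 1.

(** The endpoints 0 and 1 are null, so the uniform law can be computed on the open interval, where
    the quantile function is given by its formula. *)
Lemma uniform_prob01E (R : realType) (A : set R) : measurable A ->
  uniform_prob (@ltr01 R) A = lebesgue_measure (A `&` `]0, 1[).
Proof.
move=> mA; have mI (i : interval R) : measurable_fun [set` i] (EFin \o \1_A : R -> \bar R).
  by apply: measurable_funTS; apply/measurable_EFinP; exact: measurable_indic.
rewrite /uniform_prob integral_uniform_pdf -integral_indic//.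
rewrite integral_itv_bndo_bndc// integral_itv_obnd_cbnd//.
rewrite integral_mkcondl; apply: eq_integral => u.
rewrite inE/= in_itv/= => u01.
by rewrite patchE /uniform_pdf u01 subr0 invr1 indicE; case: ifPn.
Qed.

Lemma powR_gt1 (R : realType) (a p : R) : 1 < a -> 0 < p -> 1 < a `^ p.
Proof.
move=> a1 p0; have a0 : 0 < a by rewrite (lt_trans _ a1).
by rewrite /powR gt_eqF// expR_gt1 mulr_gt0// ln_gt0.
Qed.

(** The truncation removes a jump at 0: [powR] takes the value 1 at negative bases. At 0 both
    one-sided limits are 0 because [p] is positive. *)
Lemma continuous_powR_pos_part (R : realType) (p : R) : 0 < p ->
  continuous (fun x : R => Num.max x 0 `^ p).
Proof.
move=> p0 x; have [x0|x0|->] := ltgtP x 0.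
- apply: (near_cst_continuous (0 `^ p)).
  by near=> y; rewrite max_r// ltW//; near: y; exact: lt_nbhsl.
- rewrite /prop_for /continuous_at /= (max_l (ltW x0)).
  have cx : y `^ p @[y --> x] --> x `^ p.
    suff /differentiable_continuous : differentiable (@powR R ^~ p) x by [].
    apply/derivable1_diffP.
    by apply: derivable_powR; rewrite in_itv/= andbT.
  apply: cvg_trans cx; apply: near_eq_cvg; near=> y.
  by rewrite max_l// ltW//; near: y; exact: lt_nbhsr.
- apply/left_right_continuousP; rewrite /= maxxx powR0 ?gt_eqF//; split.
  + apply: cvg_near_cst; near=> y.
    by rewrite max_r ?powR0 ?gt_eqF// ltW.
  + apply: cvg_trans (powR_cvg0 p0); apply: near_eq_cvg; near=> y.
    by rewrite max_l// ltW.
Unshelve. all: by end_near. Qed.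

Section gen_log_logistic.
Context {R : realType} {alpha : R} {k : nat}.
Hypotheses (alpha_gt0 : 0 < alpha) (k_gt0 : (0 < k)%N).

Local Notation F := (gen_log_logistic_df alpha k).
Local Notation q := (gen_log_logistic_quantile alpha k).

Let kR_gt0 : 0 < k%:R :> R. Proof. by rewrite ltr0n. Qed.

Lemma gen_log_logistic_df_itv01 x : 0 < x -> 0 < F x < 1.
Proof.
move=> x0; rewrite /gen_log_logistic_df x0 powR_gt0/=; last first.
  by rewrite ltr_wpDr// powR_ge0.
rewrite (powRN _ k%:R^-1) invf_lt1 ?powR_gt0 ?ltr_wpDr ?powR_ge0//.
by rewrite powR_gt1 ?invr_gt0// ltrDl powR_gt0.
Qed.

(** Clearing the negative power of [x] gives one formula on both sides of 0, from which continuity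
    at 0 can be read off. *)
Lemma gen_log_logistic_df_pos_partE x :
  F x = (Num.max x 0 `^ alpha / (1 + Num.max x 0 `^ alpha)) `^ k%:R^-1.
Proof.
rewrite /gen_log_logistic_df; case: ifPn => [x0|]; last first.
  rewrite -leNgt => x0; rewrite max_r// powR0 ?gt_eqF// mul0r powR0//.
  by rewrite gt_eqF// invr_gt0.
rewrite max_l ?ltW//.
have y0 : 0 < x `^ alpha by rewrite powR_gt0.
have -> : 1 + x `^ (- alpha) = (x `^ alpha / (1 + x `^ alpha))^-1.
  by rewrite powRN; field; rewrite !gt_eqF// addr_gt0.
rewrite -[(_ / _)^-1]powR_inv1 ?divr_ge0 ?addr_ge0 ?powR_ge0//.
by rewrite -powRrM; congr (_ `^ _); ring.
Qed.

Lemma continuous_gen_log_logistic_df : continuous F.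
Proof.
(* The outer truncation changes nothing, the quotient being nonnegative; it gives both powers the
   form known to be continuous. *)
have -> : F = (fun z => Num.max z 0 `^ k%:R^-1) \o
    (fun x => Num.max x 0 `^ alpha / (1 + Num.max x 0 `^ alpha)).
  apply/funext => x /=; rewrite gen_log_logistic_df_pos_partE [in RHS]max_l//.
  by rewrite divr_ge0 ?addr_ge0 ?powR_ge0.
move=> x; apply: continuous_comp; last first.
  by apply: continuous_powR_pos_part; rewrite invr_gt0.
apply: cvgM; first exact: continuous_powR_pos_part.
apply: cvgV; first by rewrite gt_eqF// ltr_wpDr ?powR_ge0.
by apply: cvgD; [exact: cvg_cst|exact: continuous_powR_pos_part].
Qed.

Lemma gen_log_logistic_df_lt x y : 0 < x -> x < y -> F x < F y.
Proof.
move=> x0 xy; have y0 := lt_trans x0 xy.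
rewrite /gen_log_logistic_df x0 y0 !(powRN _ k%:R^-1).
rewrite ltf_pV2 ?posrE ?powR_gt0 ?ltr_wpDr ?powR_ge0//.
rewrite gt0_ltr_powR ?invr_gt0 ?nnegrE ?addr_ge0 ?powR_ge0// ltrD2l.
rewrite !powRN ltf_pV2 ?posrE ?powR_gt0//.
by rewrite gt0_ltr_powR ?nnegrE ?ltW.
Qed.

Lemma gen_log_logistic_quantile_gt0 u : 0 < q u.
Proof.
rewrite /gen_log_logistic_quantile; case: ifPn => // /andP[u0 u1].
rewrite powR_gt0// subr_gt0 powRN powR_mulrn ?ltW//.
by rewrite invf_gt1 ?exprn_gt0// exprn_ilt1 ?ltW// -lt0n.
Qed.

Lemma gen_log_logistic_quantileK u : 0 < u < 1 -> F (q u) = u.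
Proof.
move=> u01; have := gen_log_logistic_quantile_gt0 u.
rewrite /gen_log_logistic_df => ->; rewrite /gen_log_logistic_quantile u01.
case/andP: u01 => u0 u1.
have ge0 : 0 <= u `^ (- k%:R) - 1.
  by rewrite powRN powR_mulrn ?(ltW u0)// subr_ge0 invf_ge1 ?exprn_gt0// exprn_ile1 ?ltW.
rewrite -powRrM mulrNN mulVf ?gt_eqF// powRr1// addrC subrK.
by rewrite -powRrM mulrNN divff ?gt_eqF// powRr1// ltW.
Qed.

(** [F] is strictly increasing on the positive axis and [F (q u) = u]. This turns the event
    [q u <= x] into an interval of values of [u]. *)
Lemma gen_log_logistic_quantile_le u x : 0 < u < 1 -> 0 < x ->
  (q u <= x) = (u <= F x).
Proof.
move=> u01 x0; rewrite -{2}(gen_log_logistic_quantileK u01).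
have [xq|qx|->] := ltgtP x (q u); last by rewrite lexx.
- by rewrite [RHS]leNgt gen_log_logistic_df_lt.
- by rewrite ltW// gen_log_logistic_df_lt// gen_log_logistic_quantile_gt0.
Qed.

Lemma measurable_gen_log_logistic_quantile : measurable_fun setT q.
Proof.
apply: measurable_fun_ifT => //.
  by apply: measurable_and => //; exact: measurable_fun_ltr.
apply: (@measurableT_comp _ _ _ _ _ _ (@powR R ^~ (- alpha^-1))).
  exact: measurable_powR.
by apply: measurable_funB => //; exact: measurable_powR.
Qed.

HB.instance Definition _ := @isMeasurableFun.Build _ _ _ _
  (q : measurableTypeR R -> R) measurable_gen_log_logistic_quantile.

Lemma positive_continuous_df_gen_log_logistic_df : positive_continuous_df F.
Proof.
split; first exact: continuous_gen_log_logistic_df.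
exists _, _, (uniform_prob (@ltr01 R)), (q : {mfun measurableTypeR R >-> R}).
split; first exact: gen_log_logistic_quantile_gt0.
move=> x; rewrite /cdf /distribution /pushforward/=.
have mqx : measurable (q @^-1` `]-oo, x]).
  by rewrite -[X in measurable X]setTI; exact: measurable_gen_log_logistic_quantile.
have [x0|x0] := leP x 0.
  rewrite (_ : q @^-1` _ = set0) ?measure0.
    by rewrite /gen_log_logistic_df ltNge x0.
  rewrite -subset0 => u /=; rewrite in_itv/=; apply/negP; rewrite -ltNge.
  exact: le_lt_trans (gen_log_logistic_quantile_gt0 u).
rewrite uniform_prob01E//.
have /andP[F0 F1] := gen_log_logistic_df_itv01 x0.
(* The right endpoint survives the intersection with the open unit interval because [F x < 1]. *)
rewrite (_ : _ `&` _ = `]0, F x]%classic).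
  by rewrite lebesgue_measure_itv/= lte_fin F0 sube0.
apply/seteqP; split=> u /=; rewrite !in_itv/=.
  by move=> [qx u01]; rewrite -gen_log_logistic_quantile_le// qx andbT; case/andP: u01.
move=> /andP[u0 uF]; have u01 : 0 < u < 1 by rewrite u0 (le_lt_trans uF).
by rewrite gen_log_logistic_quantile_le.
Qed.

(** Put a = c^(-alpha) and y = x^(-alpha). Then F(x)^k = 1/(1+y), so the Harris denominator is the
    k-th root of (1+ay)/(1+y). Its factor in 1+y cancels against F(x), and ay = (cx)^(-alpha). *)
Lemma Harris_pgf_gen_log_logistic_df (c x : R) : 0 < c -> 0 < x ->
  Harris_pgf (c `^ (- alpha)) k (F x) = F (c * x).
Proof.
move=> c0 x0; rewrite /Harris_pgf /gen_log_logistic_df mulr_gt0// x0.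
rewrite powRM ?ltW//.
set a := c `^ _; set y := x `^ _.
have a0 : 0 < a by rewrite powR_gt0.
have y0 : 0 < y by rewrite powR_gt0.
have y1 : 0 < 1 + y by exact: addr_gt0.
have ay1 : 0 < 1 + a * y by rewrite addr_gt0// mulr_gt0.
have -> : (1 + y) `^ (- k%:R^-1) ^+ k = (1 + y)^-1.
  by rewrite -powR_mulrn ?powR_ge0// -powRrM mulNr mulVf ?gt_eqF// powR_inv1// ltW.
have -> : a - (a - 1) / (1 + y) = (1 + a * y) / (1 + y) by field; rewrite gt_eqF.
rewrite powRM ?invr_ge0 ?ltW//.
rewrite -[(1 + y)^-1]powR_inv1 ?(ltW y1)// -powRrM mulN1r.
by rewrite invfM mulrCA divff ?mulr1 ?powRN// gt_eqF// invr_gt0 powR_gt0.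
Qed.

End gen_log_logistic.

(** Positivity of [N] excludes the term 0^0 = 1. *)
Lemma pgf0 d (T : measurableType d) (R : realType) (P : probability T R)
    (N : {RV P >-> nat}) : (forall w, (0 < N w)%N) -> pgf N 0 = 0%E.
Proof.
move=> N0; rewrite /pgf (_ : (fun _ => _) = cst 0) ?expectation_cst//.
by apply/funext => w; rewrite expr0n gtn_eqF.
Qed.

Lemma pgf1 d (T : measurableType d) (R : realType) (P : probability T R)
    (N : {RV P >-> nat}) : pgf N 1 = 1%E.
Proof.
rewrite /pgf (_ : (fun _ => _) = cst 1) ?expectation_cst//.
by apply/funext => w; rewrite expr1n.
Qed.

Theorem mainTheorem6 (R : realType) (k : nat) (hk : (1 <= k)%N)
    (alpha : R) (halpha : 0 < alpha)
    (d : measure_display) (T : measurableType d) (P : probability T R)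
    (N : {RV P >-> nat}) (hN : forall w : T, (1 <= N w)%N)
    (c : R) (hc : 0 < c < 1) :
  max_stable N c (gen_log_logistic_df alpha k) <->
  has_Harris_law N (c `^ (- alpha)) k.
Proof.
have /andP[c0 c1] := hc.
split=> [[_ _ _ FE]|[_ _ _ QE]]; split=> //.
(* The Harris parameter exceeds 1, being (1/c)^alpha with 1/c > 1. *)
- rewrite -mulN1r powRrM powR_inv1 ?ltW//.
  by rewrite powR_gt1// invf_gt1.
- move=> s /andP[]; rewrite le_eqVlt => /predU1P[<- _|s0].
    by rewrite pgf0// /Harris_pgf mul0r.
  rewrite le_eqVlt => /predU1P[->|s1].
    by rewrite pgf1 /Harris_pgf expr1n mulr1 subKr powR1 divr1.
  have s01 : 0 < s < 1 by rewrite s0.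
  (* The functional equation is used at the point [q s], where [F] takes the value [s]. *)
  have q0 := gen_log_logistic_quantile_gt0 (alpha := alpha) hk s.
  have sE := gen_log_logistic_quantileK halpha hk s01.
  by rewrite -[in LHS]sE FE// -Harris_pgf_gen_log_logistic_df// sE.
- exact: positive_continuous_df_gen_log_logistic_df.
(* Conversely, the Harris formula is used at [s = F x], which lies in the unit interval. *)
- move=> x x0; rewrite QE ?Harris_pgf_gen_log_logistic_df//.
  by have /andP[F0 F1] := gen_log_logistic_df_itv01 (alpha := alpha) hk x0; rewrite !ltW.
Qed.
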